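(* Let $R>0$, $k\ge0$ be an integer, and $n\ge k+2$. (i) For every starting point $\mathbf z^0\in\mathbb R^n\times\mathbb R^n$ there exists an $R$-smooth biaffine function $\mathbf L$ on $\mathbb R^n\times\mathbb R^n$ such that for every algorithm in $\mathfrak A_{\mathrm{sep}}$ started at $\mathbf z^0$, the $k$-th iterate $\mathbf z^k$ satisfies $$\|\nabla\mathbf L(\mathbf z^k)\|^2\ge\frac{R^2\|\mathbf z^0-\mathbf z^\star\|^2}{(2\lfloor k/2\rfloor+1)^2},$$ where $\mathbf z^\star$ is the saddle point of $\mathbf L$ closest to $\mathbf z^0$. (ii) This bound cannot be improved using biaffine functions: for every $D>0$, $$\inf_{\mathcal A\in\mathfrak A_{\mathrm{sep}}}\ \sup\ \|\nabla\mathbf L(\mathbf z^k)\|^2=\frac{R^2D^2}{(2\lfloor k/2\rfloor+1)^2},$$ where the supremum ranges over all $R$-smooth biaffine $\mathbf L$ on $\mathbb R^n\times\mathbb R^n$ and all $\mathbf z^0$ at distance at most $D$ from some saddle point of $\mathbf L$, and $\mathbf z^k$ denotes the $k$-th iterate of $\mathcal A$ applied to $\mathbf L$ from $\mathbf z^0$.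
   Context: Write $\mathbf z=(\mathbf x,\mathbf y)\in\mathbb R^n\times\mathbb R^n$. $\mathbf L$ is biaffine if it is affine in $\mathbf x$ for each fixed $\mathbf y$ and affine in $\mathbf y$ for each fixed $\mathbf x$. A saddle point $(\mathbf x^\star,\mathbf y^\star)$ satisfies $\mathbf L(\mathbf x^\star,\mathbf y)\le\mathbf L(\mathbf x^\star,\mathbf y^\star)\le\mathbf L(\mathbf x,\mathbf y^\star)$ for all $\mathbf x,\mathbf y$. $\mathbf G(\mathbf z)=(\nabla_{\mathbf x}\mathbf L,-\nabla_{\mathbf y}\mathbf L)$; $\mathbf L$ is $R$-smooth if $\mathbf G$ is $R$-Lipschitz. A deterministic algorithm $\mathcal A$ produces, from a starting point $\mathbf z^0=(\mathbf x^0,\mathbf y^0)$ and a function $\mathbf L$, iterates $\mathbf z^j=\mathcal A(\mathbf z^0,\dots,\mathbf z^{j-1};\mathbf L)$, $j\ge1$. The class $\mathfrak A_{\mathrm{sep}}$ consists of such algorithms whose iterates always satisfy, for all $j\ge1$, $\mathbf x^j\in\mathbf x^0+\mathrm{span}\{\nabla_{\mathbf x}\mathbf L(\mathbf x^0,\mathbf y^0),\dots,\nabla_{\mathbf x}\mathbf L(\mathbf x^{j-1},\mathbf y^{j-1})\}$ and $\mathbf y^j\in\mathbf y^0+\mathrm{span}\{\nabla_{\mathbf y}\mathbf L(\mathbf x^0,\mathbf y^0),\dots,\nabla_{\mathbf y}\mathbf L(\mathbf x^{j-1},\mathbf y^{j-1})\}$. *)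

(* Defs.v *)
From HB Require Import structures.
From mathcomp Require Import all_boot all_order all_algebra.
From mathcomp Require Import all_classical all_reals all_analysis.
Set Implicit Arguments. Unset Strict Implicit. Unset Printing Implicit Defensive.
Import Order.TTheory GRing.Theory Num.Theory.
Local Open Scope ring_scope.

Section Defs.
Variables (R : realType) (n : nat).

Definition pt := ('rV[R]_n * 'rV[R]_n)%type.

Definition sqnormv (v : 'rV[R]_n) : R := \sum_(i < n) v 0 i ^+ 2.
Definition sqnorm (z : pt) : R := sqnormv z.1 + sqnormv z.2.
Definition enorm (z : pt) : R := Num.sqrt (sqnorm z).
Definition ptsub (z w : pt) : pt := (z.1 - w.1, z.2 - w.2).

Definition affine (f : 'rV[R]_n -> R) : Prop :=
  forall (a b : 'rV[R]_n) (t : R),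
    f (t *: a + (1 - t) *: b) = t * f a + (1 - t) * f b.

Definition biaffine (L : pt -> R) : Prop :=
  (forall y, affine (fun x => L (x, y))) /\ (forall x, affine (fun y => L (x, y))).

Definition saddle (L : pt -> R) (zs : pt) : Prop :=
  forall x y, L (zs.1, y) <= L zs /\ L zs <= L (x, zs.2).

Definition gradx (L : pt -> R) (z : pt) : 'rV[R]_n :=
  \row_i derive1 (fun t : R => L (z.1 + t *: delta_mx 0 i, z.2)) 0.
Definition grady (L : pt -> R) (z : pt) : 'rV[R]_n :=
  \row_i derive1 (fun t : R => L (z.1, z.2 + t *: delta_mx 0 i)) 0.

Definition grad (L : pt -> R) (z : pt) : pt := (gradx L z, grady L z).
Definition Gop (L : pt -> R) (z : pt) : pt := (gradx L z, - grady L z).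

Definition smooth (r : R) (L : pt -> R) : Prop :=
  forall z w, enorm (ptsub (Gop L z) (Gop L w)) <= r * enorm (ptsub z w).

(* deterministic algorithms: z^j = A L [:: z^0; ...; z^(j-1)] *)
Definition algorithm := (pt -> R) -> seq pt -> pt.

Fixpoint history (A : algorithm) (L : pt -> R) (z0 : pt) (j : nat) : seq pt :=
  if j is j'.+1 then rcons (history A L z0 j') (A L (history A L z0 j'))
  else [:: z0].

Definition iterate (A : algorithm) (L : pt -> R) (z0 : pt) (j : nat) : pt :=
  nth z0 (history A L z0 j) j.

Definition in_Asep (A : algorithm) : Prop :=
  forall (L : pt -> R) (z0 : pt) (j : nat), (0 < j)%N ->
    ((iterate A L z0 j).1 - z0.1
       \in <<[seq gradx L (iterate A L z0 i) | i <- iota 0 j]>>%VS) /\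
    ((iterate A L z0 j).2 - z0.2
       \in <<[seq grady L (iterate A L z0 i) | i <- iota 0 j]>>%VS).

Definition closest_saddle (L : pt -> R) (z0 zs : pt) : Prop :=
  saddle L zs /\ forall s, saddle L s -> enorm (ptsub z0 zs) <= enorm (ptsub z0 s).

End Defs.

(* Main.v *)
(* For a biaffine L with saddle point s, the gradient is z |-> M (z - s) with M = [0 A; A^T 0]
   symmetric of norm at most r. Write m = floor(k/2) and N = 2m+1.

   Upper bound: k steps of a separate-span method reach z0 + sum_(1 <= i <= k) c_i M^i (z0 - s)
   for any prescribed c_i; a suitable choice gives the gradient +-(r/N) T_N(M/r) (z0 - s). Pell's identity
   T_N^2 + (1 - X^2) U_(N-1)^2 = 1 shows that T_N(M/r) is a contraction without any
   spectral theory.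

   Lower bound: A is r times the averaging of neighbours on a cycle of odd length N, and
   x0 - s alternates in sign, so that at the start only one y-coordinate has a nonzero
   gradient. Information travels one half-edge per step, so the x-coordinate at the opposite
   end is still untouched at time k. The alternating sum of the averages telescopes
   to this coordinate, and Cauchy-Schwarz bounds the gradient from below. *)
Require Import Defs.
From HB Require Import structures.
From mathcomp Require Import all_boot all_order all_algebra.
From mathcomp Require Import all_classical all_reals all_analysis.
From mathcomp Require Import ring lra zify.
Import Order.TTheory GRing.Theory Num.Theory.
Local Open Scope ring_scope.

(** * Squared Euclidean norms of row vectors *)

Lemma sqnormvE {R : realType} {n : nat} (v : 'rV[R]_n) :
  sqnormv v = (v *m v^T) 0 0.
Proof. by rewrite mxE; apply: eq_bigr => i _; rewrite mxE expr2. Qed.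

Lemma sqnormv_ge0 {R : realType} {n : nat} (v : 'rV[R]_n) : 0 <= sqnormv v.
Proof. by apply: sumr_ge0 => i _; rewrite sqr_ge0. Qed.

Lemma sqnormvZ {R : realType} {n : nat} (a : R) (v : 'rV[R]_n) :
  sqnormv (a *: v) = a ^+ 2 * sqnormv v.
Proof. by rewrite mulr_sumr; apply: eq_bigr => i _; rewrite mxE exprMn. Qed.

Lemma sqnormvN {R : realType} {n : nat} (v : 'rV[R]_n) :
  sqnormv (- v) = sqnormv v.
Proof. by apply: eq_bigr => i _; rewrite mxE sqrrN. Qed.

Lemma sqnormv_row_mx {R : realType} {n : nat} (z : pt R n) :
  sqnormv (row_mx z.1 z.2) = sqnorm z.
Proof.
rewrite /sqnorm /sqnormv big_split_ord /=.
by congr (_ + _); apply: eq_bigr => i _; rewrite ?row_mxEl ?row_mxEr.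
Qed.

(** * Chebyshev polynomials and their action on symmetric matrices *)

(* The pair of Chebyshev polynomials [T_j (a X)] and [U_(j-1) (a X)], generated by
   the angle-addition formulas for cosine and sine. *)
Fixpoint cheb {R : realType} (a : R) (j : nat) : {poly R} * {poly R} :=
  if j is j'.+1 then
    let: (t, u) := cheb a j' in
    let y := a *: 'X in (y * t - (1 - y ^+ 2) * u, y * u + t)
  else (1, 0).

Lemma chebS {R : realType} (a : R) (j : nat) (y := a *: 'X : {poly R}) :
  cheb a j.+1 = (y * (cheb a j).1 - (1 - y ^+ 2) * (cheb a j).2,
                 y * (cheb a j).2 + (cheb a j).1).
Proof. by rewrite /=; case: (cheb a j). Qed.

Lemma cheb_pell {R : realType} (a : R) (j : nat) :
  (cheb a j).1 ^+ 2 + (1 - (a *: 'X) ^+ 2) * (cheb a j).2 ^+ 2 = 1.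
Proof.
elim: j => [|j IHj]; first by rewrite /= expr1n expr0n /= mulr0 addr0.
rewrite chebS -[RHS]IHj /=.
by move: (a *: 'X) (cheb a j).1 (cheb a j).2 => y t u; ring.
Qed.

Lemma size_cheb {R : realType} (a : R) (j : nat) :
  (size (cheb a j).1 <= j.+1)%N /\ (size (cheb a j).2 <= j)%N.
Proof.
have sX : (size (a *: 'X : {poly R}) <= 2)%N.
  by rewrite (leq_trans (size_scale_leq _ _)) ?size_polyX.
have sM (p : {poly R}) d : (size p <= d -> size ((a *: 'X) * p)%R <= d.+1)%N.
  move=> le_p; apply: leq_trans (size_polyMleq _ _) _.
  by move: sX le_p; lia.
elim: j => [|j [IHt IHu]]; first by rewrite /= size_poly1 size_poly0.
rewrite chebS /=; split.
  apply: leq_trans (size_polyD _ _) _; rewrite size_polyN geq_max sM //=.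
  rewrite mulrBl mul1r expr2 -mulrA.
  apply: leq_trans (size_polyD _ _) _; rewrite size_polyN geq_max.
  by rewrite !sM // (leq_trans IHu) //; lia.
by apply: leq_trans (size_polyD _ _) _; rewrite geq_max sM.
Qed.

(** A vanishing constant term and a linear coefficient of size [a * (2 * m + 1)] let a multiple of
    [t] have the form [X] plus higher powers; this linear coefficient is the source of the rate. *)
Lemma cheb_coef01 {R : realType} (a : R) (m : nat) (t := (cheb a m.*2.+1).1) :
  t`_0 = 0 /\ t`_1 = (-1) ^+ m * (a * (2 * m + 1)%:R).
Proof.
have coefs j : [/\ (cheb a j.+1).1`_0 = - (cheb a j).2`_0,
    (cheb a j.+1).2`_0 = (cheb a j).1`_0,
    (cheb a j.+1).1`_1 = a * (cheb a j).1`_0 - (cheb a j).2`_1 &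
    (cheb a j.+1).2`_1 = a * (cheb a j).2`_0 + (cheb a j).1`_1].
  rewrite chebS /= mulrBl mul1r exprZn -!scalerAl.
  by rewrite !(coefD, coefN, coefZ, coefXM, coefXnM) /=; split; ring.
(* At an even index [T] is an even polynomial and [U] an odd one, so the induction runs in steps of
   two. *)
have [t0 u0 t1 u1] : [/\ (cheb a m.*2).1`_0 = (-1) ^+ m,
    (cheb a m.*2).2`_0 = 0, (cheb a m.*2).1`_1 = 0 &
    (cheb a m.*2).2`_1 = - (-1) ^+ m * (a * (2 * m)%:R)].
  elim: m {t} => [|m [t0 u0 t1 u1]]; first by rewrite /= !coefE /=; split => //; ring.
  rewrite doubleS; have [-> -> -> ->] := coefs m.*2.+1.
  have [-> -> -> ->] := coefs m.*2.
  rewrite t0 u0 t1 u1 exprS; split; try ring.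
have [E0 _ E1 _] := coefs m.*2.
by rewrite /t E0 E1 t0 u0 u1; split; ring.
Qed.

Lemma trmx_horner_mx {R : comNzRingType} {d : nat} (M : 'M[R]_d.+1) (p : {poly R}) :
  (horner_mx M p)^T = horner_mx M^T p.
Proof.
elim/poly_ind: p => [|p c IHp]; first by rewrite !rmorph0 trmx0.
rewrite !rmorphD !rmorphM /= !horner_mx_X !horner_mx_C linearD /= tr_scalar_mx.
rewrite -!mulmxE trmx_mul IHp; congr (_ + _).
by rewrite (comm_mx_horner _ (comm_mx_refl _)).
Qed.

(* Pell's identity [T^2 + (1 - a^2 X^2) U^2 = 1] reads
   [|v T(M)|^2 + |v U(M)|^2 - a^2 |v U(M) M|^2 = |v|^2]. *)
Lemma cheb_contraction {R : realType} {d : nat} (M : 'M[R]_d.+1) (r : R) (j : nat) :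
  0 < r -> M^T = M -> (forall v, sqnormv (v *m M) <= r ^+ 2 * sqnormv v) ->
  forall v, sqnormv (v *m horner_mx M (cheb r^-1 j).1) <= sqnormv v.
Proof.
move=> r0 Msym Mle v.
set t := (cheb _ _).1; set u := (cheb r^-1 j).2.
have pell := congr1 (horner_mx M) (cheb_pell r^-1 j).
rewrite -/t -/u in pell.
have normp p : sqnormv (v *m horner_mx M p) = (v *m horner_mx M (p ^+ 2) *m v^T) 0 0.
  rewrite sqnormvE trmx_mul trmx_horner_mx Msym expr2 rmorphM.
  by rewrite -mulmxE !mulmxA.
have phiP c W W' W'' : (v *m (W + (W' - c *: W'')) *m v^T) 0 0 =
    (v *m W *m v^T) 0 0 + ((v *m W' *m v^T) 0 0 - c * (v *m W'' *m v^T) 0 0).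
  rewrite mulmxDr mulmxBr mulmxDl mulmxBl -scalemxAr -scalemxAl.
  by move: (v *m W *m _) (v *m W' *m _) (v *m W'' *m _) => B B' B''; rewrite !mxE.
have hZ c p : horner_mx M (c *: p) = c *: horner_mx M p.
  by rewrite -mul_polyC rmorphM /= horner_mx_C -mulmxE mul_scalar_mx.
have := congr1 (fun W => (v *m W *m v^T) 0 0) pell.
have -> : (1 - (r^-1 *: 'X) ^+ 2) * u ^+ 2 = u ^+ 2 - r ^- 2 *: (u * 'X) ^+ 2.
  by rewrite exprZn exprVn mulrBl mul1r -scalerAl exprMn mulrC.
rewrite rmorph1 mulmx1 -sqnormvE rmorphD rmorphB /= hZ phiP -!normp => <-.
rewrite rmorphM /= horner_mx_X -mulmxE mulmxA.
(* The surplus [|v U(M)|^2 - r^-2 |v U(M) M|^2] is nonnegative by [Mle] at the vector [v U(M)]. *)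
by rewrite lerDl subr_ge0 ler_pdivrMl ?exprn_gt0.
Qed.

(** * Gradients of biaffine functions *)

Lemma derive1_affine {R : realType} (b c : R) :
  derive1 (fun t : R => b + t * c) 0 = c.
Proof.
have H : is_derive (0 : R) (1 : R) (fun t : R => b + t * c) c.
  by apply: is_derive_eq; rewrite /GRing.scale /=; ring.
by rewrite derive1E; exact: derive_val.
Qed.

Lemma affine_slope {R : realType} {n : nat} {f : 'rV[R]_n -> R} :
  affine f -> forall x d t, f (x + t *: d) = f x + t * (f (x + d) - f x).
Proof.
move=> fA x d t.
have -> : x + t *: d = t *: (x + d) + (1 - t) *: x.
  by rewrite scalerDr scalerBl scale1r [RHS]addrC addrA subrK.
by rewrite fA; ring.
Qed.

Lemma affine_diff {R : realType} {n : nat} {f : 'rV[R]_n -> R} :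
  affine f -> forall x d, f (x + d) - f x = f d - f 0.
Proof.
move=> fA x d.
(* [x + d] is the midpoint of [2 x] and [2 d]; the slopes from 0 then undo the doubling. *)
have E1 := fA (2 *: x) (2 *: d) 2^-1.
have half : 1 - 2^-1 = 2^-1 :> R by lra.
rewrite half !scalerA mulVf ?pnatr_eq0 // !scale1r in E1.
have := affine_slope fA 0 x 2; have := affine_slope fA 0 d 2.
by rewrite !add0r E1 => -> ->; lra.
Qed.

Lemma affine_sum {R : realType} {n : nat} {f : 'rV[R]_n -> R} :
  affine f -> forall x, f x = f 0 + \sum_j x 0 j * (f (delta_mx 0 j) - f 0).
Proof.
move=> fA x; rewrite {1}[x]row_sum_delta.
elim/big_ind2 : _ => [|u a v b|j _]; first by rewrite addr0.
  by move=> fa fb; rewrite -[LHS](subrK (f a)) (affine_diff fA) fa fb; ring.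
by have := affine_slope fA 0 (delta_mx 0 j) (x 0 j); rewrite !add0r => ->.
Qed.

Lemma affineB {R : realType} {n : nat} {f g : 'rV[R]_n -> R} :
  affine f -> affine g -> affine (fun x => f x - g x).
Proof. by move=> fA gA a b t; rewrite fA gA; ring. Qed.

Lemma gradx_biaffine {R : realType} {n : nat} {L : pt R n -> R} :
  biaffine L -> forall x y i, gradx L (x, y) 0 i = L (delta_mx 0 i, y) - L (0, y).
Proof.
move=> [Lx _] x y i; rewrite mxE /=.
under eq_fun do rewrite (affine_slope (Lx y)).
by rewrite derive1_affine (affine_diff (Lx y)).
Qed.

Lemma grady_biaffine {R : realType} {n : nat} {L : pt R n -> R} :
  biaffine L -> forall x y i, grady L (x, y) 0 i = L (x, delta_mx 0 i) - L (x, 0).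
Proof.
move=> [_ Ly] x y i; rewrite mxE /=.
under eq_fun do rewrite (affine_slope (Ly x)).
by rewrite derive1_affine (affine_diff (Ly x)).
Qed.

Lemma saddle_grad0 {R : realType} {n : nat} {L : pt R n -> R} {s : pt R n} :
  biaffine L -> saddle L s -> gradx L s = 0 /\ grady L s = 0.
Proof.
case: s => xs ys [Lx Ly] sad; split; apply/rowP => i.
- rewrite gradx_biaffine // [RHS]mxE -(affine_diff (Lx ys) xs).
  (* Moving by [- c] along the [i]-th axis changes the value by [- c ^+ 2], which the saddle
     inequality forbids unless [c = 0]. *)
  set c := _ - _; have [_] := sad (xs + (- c) *: delta_mx 0 i) ys.
  rewrite /= (affine_slope (Lx ys)) -/c => H.
  by apply/eqP; rewrite -sqrf_eq0; apply/eqP; nra.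
- rewrite grady_biaffine // [RHS]mxE -(affine_diff (Ly xs) ys).
  set c := _ - _; have [+ _] := sad xs (ys + c *: delta_mx 0 i).
  rewrite /= (affine_slope (Ly xs)) -/c => H.
  by apply/eqP; rewrite -sqrf_eq0; apply/eqP; nra.
Qed.

Lemma biaffine_grad {R : realType} {n : nat} {L : pt R n -> R} {s : pt R n} :
  biaffine L -> saddle L s ->
  exists A : 'M[R]_n,
    forall z, grad L z = ((z.2 - s.2) *m A^T, (z.1 - s.1) *m A).
Proof.
move=> BL; have [Lx Ly] := BL; case: s => xs ys /(saddle_grad0 BL) [gx0 gy0].
pose e i : 'rV[R]_n := delta_mx 0 i.
(* The mixed second differences of [L] at 0, that is, its constant mixed Hessian. Subtracting the
   zero gradient at the saddle point then cancels the constant terms. *)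
pose A : 'M[R]_n := \matrix_(i, j) (L (e i, e j) - L (0, e j) - (L (e i, 0) - L (0, 0))).
have cancel (a b c : R) : a + b - (a + c) = b - c by ring.
exists A => -[x y]; rewrite /grad /=; congr pair; apply/rowP => i.
- transitivity (gradx L (x, y) 0 i - gradx L (xs, ys) 0 i).
    by rewrite gx0 [X in _ - X]mxE subr0.
  rewrite !gradx_biaffine //.
  rewrite (affine_sum (affineB (Ly (e i)) (Ly 0)) y).
  rewrite (affine_sum (affineB (Ly (e i)) (Ly 0)) ys).
  rewrite cancel -sumrB [RHS]mxE; apply: eq_bigr => j _.
  by rewrite !mxE mulrBl.
- transitivity (grady L (x, y) 0 i - grady L (xs, ys) 0 i).
    by rewrite gy0 [X in _ - X]mxE subr0.
  rewrite !grady_biaffine //.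
  rewrite (affine_sum (affineB (Lx (e i)) (Lx 0)) x).
  rewrite (affine_sum (affineB (Lx (e i)) (Lx 0)) xs).
  rewrite cancel -sumrB [RHS]mxE; apply: eq_bigr => j _.
  by rewrite !mxE mulrBl; ring.
Qed.

Lemma smooth_sqnorm {R : realType} {n : nat} {L : pt R n -> R} {r : R} :
  0 <= r ->
  smooth r L <->
  forall z w, sqnorm (ptsub (Gop L z) (Gop L w)) <= r ^+ 2 * sqnorm (ptsub z w).
Proof.
have sqnorm_ge0 (z : pt R n) : 0 <= sqnorm z by rewrite addr_ge0 ?sqnormv_ge0.
move=> r0; split=> H z w; have := H z w; rewrite /enorm.
  rewrite -(ler_pXn2r (n := 2)) ?nnegrE ?sqrtr_ge0 ?mulr_ge0 ?sqrtr_ge0 //.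
  by rewrite exprMn !sqr_sqrtr.
move=> Hle; rewrite -(ler_pXn2r (n := 2)) ?nnegrE ?sqrtr_ge0 ?mulr_ge0 ?sqrtr_ge0 //.
by rewrite exprMn !sqr_sqrtr.
Qed.

(** * The Krylov algorithm and the upper bound *)

Lemma horner_mx_sum {R : comNzRingType} {d : nat} (M : 'M[R]_d.+1)
    {p : {poly R}} {k : nat} :
  (size p <= k)%N -> horner_mx M p = \sum_(i < k) p`_i *: M ^+ i.
Proof.
move=> sp; have {1}-> : p = \sum_(i < k) p`_i *: 'X^i.
  rewrite -poly_def; apply/polyP => i; rewrite coef_poly; case: ltnP => // ki.
  by rewrite nth_default // (leq_trans sp).
rewrite rmorph_sum; apply: eq_bigr => i _.
by rewrite -mul_polyC rmorphM rmorphXn /= horner_mx_C horner_mx_X -mulmxE mul_scalar_mx.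
Qed.

Definition translate {R : realType} {n : nat} (z d : pt R n) : pt R n :=
  (z.1 + d.1, z.2 + d.2).

(* For biaffine [L] with gradient [z |-> M (z - s)], this is [M^(j+1) (z0 - s)]. *)
Fixpoint krylov {R : realType} {n : nat} (L : pt R n -> R) (z0 : pt R n) (j : nat) :
    pt R n :=
  if j is j'.+1 then ptsub (grad L (translate z0 (krylov L z0 j'))) (grad L z0)
  else grad L z0.

(** Before time [k] the iterates are the query points at which the next Krylov vector is computed;
    from time [k] on they stay at the prescribed combination. *)
Definition krylov_iter {R : realType} {n : nat} (k : nat) (c : nat -> R)
    (L : pt R n -> R) (z0 : pt R n) (j : nat) : pt R n :=
  if (j < k)%N then if j is j'.+1 then translate z0 (krylov L z0 j') else z0
  else translate z0 (\sum_(i < k) c i *: (krylov L z0 i).1,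
                 \sum_(i < k) c i *: (krylov L z0 i).2).

(** The [j]-th iterate is a function of [z0] and [j], so the history is read only through its first
    point and its length. A history begins with [z0], so [head] never returns its default there. *)
Definition krylov_alg {R : realType} {n : nat} (k : nat) (c : nat -> R) :
    algorithm R n :=
  fun L h => krylov_iter k c L (head (0, 0) h) (size h).

Lemma iterate_krylov_alg {R : realType} {n : nat} (k : nat) (c : nat -> R)
    (L : pt R n -> R) (z0 : pt R n) (j : nat) :
  iterate (krylov_alg k c) L z0 j = krylov_iter k c L z0 j.
Proof.
have it0 : krylov_iter k c L z0 0 = z0.
  rewrite /krylov_iter; case: ltnP => //; rewrite leqn0 => /eqP ->.
  by rewrite !big_ord0 /translate /= !addr0; case: (z0).
have hist i : history (krylov_alg k c) L z0 i = mkseq (krylov_iter k c L z0) i.+1.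
  elim: i => [|i IHi]; first by rewrite /= /mkseq /= it0.
  rewrite mkseqS -IHi [LHS]/=; congr (rcons _ _).
  by rewrite IHi /krylov_alg size_mkseq /mkseq /= it0.
by rewrite /iterate hist nth_mkseq.
Qed.

(** The vector [krylov L z0 i] is the gradient at the [i]-th query point, minus the gradient at [z0]
    if [i > 0]. Both are among the first [j] observed gradients, and this holds for arbitrary
    [L]. *)
Lemma krylov_span {R : realType} {n k : nat} (c : nat -> R)
    (L : pt R n -> R) (z0 : pt R n) {i j : nat} :
  (i < k)%N -> (i < j)%N ->
  (krylov L z0 i).1 \in <<[seq gradx L (krylov_iter k c L z0 l) | l <- iota 0 j]>>%VS /\
  (krylov L z0 i).2 \in <<[seq grady L (krylov_iter k c L z0 l) | l <- iota 0 j]>>%VS.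
Proof.
move=> ik ij.
have mem l : (l < j)%N -> l \in iota 0 j by rewrite mem_iota.
have itE : krylov_iter k c L z0 i = if i is i'.+1 then translate z0 (krylov L z0 i') else z0.
  by rewrite /krylov_iter ik.
have it0 : krylov_iter k c L z0 0 = z0 by rewrite /krylov_iter (leq_ltn_trans _ ik).
have j0 : (0 < j)%N := leq_ltn_trans (leq0n i) ij.
split.
- have gi := memv_span (map_f (fun l => gradx L (krylov_iter k c L z0 l)) (mem _ ij)).
  have g0 := memv_span (map_f (fun l => gradx L (krylov_iter k c L z0 l)) (mem _ j0)).
  rewrite itE in gi; rewrite it0 in g0.
  by case: i {ik ij itE} gi => [|i] //= gi; rewrite rpredB.
- have gi := memv_span (map_f (fun l => grady L (krylov_iter k c L z0 l)) (mem _ ij)).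
  have g0 := memv_span (map_f (fun l => grady L (krylov_iter k c L z0 l)) (mem _ j0)).
  rewrite itE in gi; rewrite it0 in g0.
  by case: i {ik ij itE} gi => [|i] //= gi; rewrite rpredB.
Qed.

Lemma krylov_alg_in_Asep {R : realType} {n : nat} (k : nat) (c : nat -> R) :
  in_Asep (krylov_alg (n := n) k c).
Proof.
move=> L z0 j j0.
under eq_map do rewrite iterate_krylov_alg.
under [X in _ /\ _ \in <<X>>%VS]eq_map do rewrite iterate_krylov_alg.
rewrite iterate_krylov_alg {1 3}/krylov_iter; case: (ltnP j k) => jk.
  case: j j0 jk => // j _ jk; rewrite /= ![_ + _ - _]addrAC !subrr !add0r.
  exact: (krylov_span c L z0 (ltnW jk) (ltnSn j)).
rewrite /= ![_ + _ - _]addrAC !subrr !add0r.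
by split; apply: rpred_sum => i _; apply: rpredZ;
  have [] := krylov_span c L z0 (ltn_ord i) (leq_trans (ltn_ord i) jk).
Qed.

(* Makes [X + \sum_(i < k) cheb_coef r k i * X^(i+2)] a multiple of the Chebyshev
   polynomial of odd degree [2 * k./2 + 1] on [[-r, r]]. *)
Definition cheb_coef {R : realType} (r : R) (k i : nat) : R :=
  (-1) ^+ k./2 * (r / (2 * k./2 + 1)%:R) * (cheb r^-1 k./2.*2.+1).1`_i.+2.

Lemma krylov_alg_rate {R : realType} {n : nat} {r : R} (k : nat)
    {L : pt R n.+1 -> R} (z0 : pt R n.+1) {s : pt R n.+1} :
  0 < r -> biaffine L -> smooth r L -> saddle L s ->
  sqnorm (grad L (iterate (krylov_alg k (cheb_coef r k)) L z0 k)) <=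
    r ^+ 2 * sqnorm (ptsub z0 s) / (2 * k./2 + 1)%:R ^+ 2.
Proof.
move=> r0 BL /(smooth_sqnorm (ltW r0)) SL sad.
have [A gradE] := biaffine_grad BL sad.
have gxE z : gradx L z = (z.2 - s.2) *m A^T by have [] := gradE z.
have gyE z : grady L z = (z.1 - s.1) *m A by have [] := gradE z.
pose M : 'M[R]_(n.+1 + n.+1) := block_mx 0 A A^T 0.
have Msym : M^T = M by rewrite tr_block_mx !trmx0 trmxK.
have mulM x y : row_mx x y *m M = row_mx (y *m A^T) (x *m A).
  by rewrite mul_row_block !mulmx0 add0r addr0.
have Mle v : sqnormv (v *m M) <= r ^+ 2 * sqnormv v.
  rewrite -(hsubmxK v); set x := lsubmx v; set y := rsubmx v.
  (* Smoothness is tested between [s + v] and [s], where the gradient vanishes; the sign in [Gop]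
     does not affect the norm. *)
  have := SL (translate s (x, y)) s; rewrite /Gop.
  have [-> ->] : gradx L s = 0 /\ grady L s = 0 by apply: saddle_grad0.
  rewrite gxE gyE /=.
  rewrite mulM (sqnormv_row_mx (y *m A^T, x *m A)) (sqnormv_row_mx (x, y)).
  rewrite /ptsub /translate /= ![_ + _ - _]addrAC !subrr !add0r !subr0.
  by rewrite !oppr0 addr0 {1}/sqnorm /= sqnormvN.
pose e := row_mx (z0.1 - s.1) (z0.2 - s.2).
have krE i : row_mx (krylov L z0 i).1 (krylov L z0 i).2 = e *m M ^+ i.+1.
  elim: i => [|i IHi]; first by rewrite /= gxE gyE expr1 mulM.
  rewrite exprSr -mulmxE mulmxA -IHi mulM /= !gxE !gyE /=.
  by rewrite -!mulmxBl; congr row_mx; congr mulmx; apply/rowP => l; rewrite !mxE; ring.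
set t := (cheb r^-1 k./2.*2.+1).1.
have [t0 t1] : t`_0 = 0 /\ t`_1 = (-1) ^+ k./2 * (r^-1 * (2 * k./2 + 1)%:R).
  exact: cheb_coef01.
pose kappa := (-1) ^+ k./2 * (r / (2 * k./2 + 1)%:R).
pose c := cheb_coef r k.
(* The degree [2 * k./2 + 1] is at most [k + 1]: [k] powers of [M] come from the steps and one from
   the last gradient. *)
have st : (size t <= k.+2)%N.
  apply: leq_trans (size_cheb _ _).1 _.
  by rewrite -{2}(odd_double_half k) !ltnS leq_addl.
have kt1 : kappa * t`_1 = 1.
  rewrite t1 /kappa mulrACA -exprMn mulN1r opprK expr1n mul1r.
  by field; rewrite lt0r_neq0 //= pnatr_eq0 addn1.
(* The gradient at the last iterate is [e M + \sum_i c_i e M^(i+2)]. As [t] has no constant term and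
   [kappa * t] has linear coefficient 1, this is [kappa * t] evaluated at [M]. *)
have gE : row_mx (gradx L (iterate (krylov_alg k c) L z0 k))
    (grady L (iterate (krylov_alg k c) L z0 k)) = kappa *: (e *m horner_mx M t).
  rewrite iterate_krylov_alg /krylov_iter ltnn.
  set z := translate _ _; rewrite gxE gyE -mulM.
  rewrite (horner_mx_sum M st) !big_ord_recl t0 scale0r add0r expr1.
  rewrite mulmxDr scalerDr -scalemxAr scalerA kt1 scale1r.
  have -> : row_mx (z.1 - s.1) (z.2 - s.2) = e + \sum_(i < k) c i *: (e *m M ^+ i.+1).
    under eq_bigr do rewrite -krE scale_row_mx.
    have -> : \sum_(i < k) row_mx (c i *: (krylov L z0 i).1) (c i *: (krylov L z0 i).2)
        = row_mx (\sum_(i < k) c i *: (krylov L z0 i).1)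
                 (\sum_(i < k) c i *: (krylov L z0 i).2).
      elim/big_rec3: _ => [|i x y w _ ->]; first by rewrite row_mx0.
      by rewrite add_row_mx.
    by rewrite add_row_mx /z /translate /= ![_ + _ - _]addrAC.
  rewrite mulmxDl; congr (_ + _).
  rewrite mulmx_suml mulmx_sumr scaler_sumr; apply: eq_bigr => i _.
  rewrite -scalemxAl -mulmxA mulmxE -exprSr -scalemxAr scalerA.
  by rewrite /c /cheb_coef /= /bump /= !add1n.
rewrite -sqnormv_row_mx gE sqnormvZ.
have le_e : sqnormv (e *m horner_mx M t) <= sqnorm (ptsub z0 s).
  rewrite -(sqnormv_row_mx (ptsub z0 s)); exact: (cheb_contraction _ _ _ r0 Msym Mle).
apply: le_trans (ler_wpM2l (sqr_ge0 _) le_e) _.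
by rewrite /kappa exprMn sqrr_sign mul1r expr_div_n mulrAC.
Qed.

(** * Averaging of neighbours on an odd cycle *)

Lemma sum_ord_lt {R : realType} {n N : nat} (F : nat -> R) :
  (N <= n)%N -> \sum_(i < n | (i < N)%N) F i = \sum_(i < N) F i.
Proof. by move=> Nn; rewrite (big_ord_widen n F Nn). Qed.

(** Cauchy-Schwarz against the all-ones vector, from expanding the nonnegative sum of the squares
    [(N F_i - S)^2]. *)
Lemma sqr_sum_le {R : realType} (N : nat) (F : nat -> R) :
  (\sum_(i < N) F i) ^+ 2 <= N%:R * \sum_(i < N) F i ^+ 2.
Proof.
case: N => [|N]; first by rewrite !big_ord0 expr0n mul0r.
set S := \sum_(i < N.+1) F i; set Q := \sum_(i < N.+1) _.
have : 0 <= \sum_(i < N.+1) (N.+1%:R * F i - S) ^+ 2.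
  by apply: sumr_ge0 => i _; rewrite sqr_ge0.
have -> : \sum_(i < N.+1) (N.+1%:R * F i - S) ^+ 2 = N.+1%:R * (N.+1%:R * Q - S ^+ 2).
  rewrite (eq_bigr (fun i : 'I_N.+1 => N.+1%:R ^+ 2 * F i ^+ 2
      + (- (2 * N.+1%:R * S) * F i + S ^+ 2))); last by move=> i _; ring.
  rewrite !big_split -!mulr_sumr sumr_const card_ord /= -/S -/Q -mulr_natl.
  by ring.
by rewrite pmulr_rge0 ?ltr0n // subr_ge0.
Qed.

Definition cyc_next (N j : nat) : nat := if (j.+1 < N)%N then j.+1 else 0%N.

(** Along the path the sum telescopes to [X 0 - X (2 m)]. The length is odd, so the closing edge
    carries a plus sign and adds [X (2 m) + X 0]. *)
Lemma cyc_alternating_sum {R : realType} (m : nat) (X : nat -> R) :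
  \sum_(j < m.*2.+1) (-1) ^+ j * (X j + X (cyc_next m.*2.+1 j)) = 2 * X 0%N.
Proof.
have tele M : \sum_(j < M) (-1) ^+ j * (X j + X j.+1) = X 0%N - (-1) ^+ M * X M.
  elim: M => [|M IHM]; first by rewrite big_ord0 expr0 mul1r subrr.
  by rewrite big_ord_recr /= IHM exprS; ring.
rewrite big_ord_recr /= {2}/cyc_next ltnn -signr_odd odd_double expr0 mul1r.
rewrite (eq_bigr (fun j : 'I_m.*2 => (-1) ^+ j * (X j + X j.+1))); last first.
  by move=> j _; rewrite /cyc_next ltnS ltn_ord.
by rewrite tele -signr_odd odd_double expr0; ring.
Qed.

(** Each term is at most [2 (a^2 + b^2)], and [cyc_next] is a rotation, so every site is counted
    twice. *)
Lemma cyc_sum_sqr_le {R : realType} (N : nat) (X : nat -> R) :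
  \sum_(j < N) (X j + X (cyc_next N j)) ^+ 2 <= 4 * \sum_(j < N) X j ^+ 2.
Proof.
have -> : 4 * \sum_(j < N) X j ^+ 2
    = \sum_(j < N) 2 * (X j ^+ 2 + X (cyc_next N j) ^+ 2).
  rewrite -mulr_sumr big_split /=.
  have -> : \sum_(j < N) X (cyc_next N j) ^+ 2 = \sum_(j < N) X j ^+ 2.
    case: N => [|N]; first by rewrite !big_ord0.
    rewrite big_ord_recr big_ord_recl /= addrC {1}/cyc_next ltnn; congr (_ + _).
    by apply: eq_bigr => j _; rewrite /cyc_next ltnS ltn_ord.
  by ring.
apply: ler_sum => j _; rewrite -subr_ge0.
have -> : 2 * (X j ^+ 2 + X (cyc_next N j) ^+ 2) - (X j + X (cyc_next N j)) ^+ 2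
    = (X j - X (cyc_next N j)) ^+ 2 by ring.
exact: sqr_ge0.
Qed.

(** The zero columns from [N] on embed the cycle in dimension [n]. For [N = 1] the two neighbours
    coincide and the single entry is [r]. *)
Definition cyc_mx {R : realType} (r : R) (n N : nat) : 'M[R]_n :=
  \matrix_(i, j) if (j < N)%N
                 then r / 2 * ((i == j :> nat)%:R + (i == cyc_next N j :> nat)%:R)
                 else 0.

Lemma cyc_nextP {N j : nat} : (j < N)%N -> (cyc_next N j < N)%N.
Proof. by rewrite /cyc_next; case: ifP => // _; apply: leq_ltn_trans. Qed.

Lemma mul_cyc_mx {R : realType} (r : R) {n N : nat} (v : 'rV[R]_n.+1) (j : 'I_n.+1) :
  (N <= n.+1)%N ->
  (v *m cyc_mx r n.+1 N) 0 j =
    if (j < N)%N then r / 2 * (v 0 (inord j) + v 0 (inord (cyc_next N j))) else 0.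
Proof.
move=> Nn; rewrite mxE; case: ifP => jN; last first.
  by apply: big1 => i _; rewrite mxE jN mulr0.
have pick l : (l < n.+1)%N -> \sum_(i < n.+1) v 0 i * (i == l :> nat)%:R = v 0 (inord l).
  move=> ln; rewrite (bigD1 (inord l)) //= inordK // eqxx mulr1 big1 ?addr0 // => i.
  by rewrite -val_eqE /= inordK // => /negPf ->; rewrite mulr0.
rewrite -!pick ?(leq_trans (cyc_nextP jN)) // -big_split mulr_sumr /=.
by apply: eq_bigr => i _; rewrite mxE jN; ring.
Qed.

Lemma sqnormv_mul_cyc_mx {R : realType} (r : R) {n N : nat} (v : 'rV[R]_n.+1)
    (X := fun i : nat => v 0 (inord i)) :
  (N <= n.+1)%N ->
  sqnormv (v *m cyc_mx r n.+1 N) =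
    (r / 2) ^+ 2 * \sum_(j < N) (X j + X (cyc_next N j)) ^+ 2.
Proof.
move=> Nn; rewrite -(sum_ord_lt (fun j => (X j + X (cyc_next N j)) ^+ 2) Nn).
rewrite mulr_sumr [RHS]big_mkcond; apply: eq_bigr => j _.
by rewrite mul_cyc_mx //; case: ifP => _; rewrite ?exprMn ?expr0n.
Qed.

Lemma cyc_mx_le {R : realType} (r : R) {n N : nat} (v : 'rV[R]_n.+1) :
  (N <= n.+1)%N -> sqnormv (v *m cyc_mx r n.+1 N) <= r ^+ 2 * sqnormv v.
Proof.
move=> Nn; rewrite sqnormv_mul_cyc_mx //.
have := cyc_sum_sqr_le N (fun i => v 0 (inord i)).
have : \sum_(j < N) v 0 (inord j) ^+ 2 <= sqnormv v.
  rewrite -(sum_ord_lt (fun j => v 0 (inord j) ^+ 2) Nn) big_mkcond.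
  by apply: ler_sum => j _; rewrite inord_val; case: ifP => _; rewrite ?sqr_ge0.
set P := \sum_(j < N) _; set Q := \sum_(j < N) _ => PS QP.
have -> : r ^+ 2 * sqnormv v = (r / 2) ^+ 2 * (4 * sqnormv v) by field.
by apply: (ler_wpM2l (sqr_ge0 _)); lra.
Qed.

(* The alternating sum of the cyclic averages around an odd cycle telescopes to the
   value at the seam. *)
Lemma cyc_mx_ge {R : realType} (r : R) {n m : nat} (v : 'rV[R]_n.+1) :
  (m.*2.+1 <= n.+1)%N ->
  r ^+ 2 * v 0 0 ^+ 2 <= m.*2.+1%:R * sqnormv (v *m cyc_mx r n.+1 m.*2.+1).
Proof.
move=> Nn; rewrite sqnormv_mul_cyc_mx //.
pose X i := v 0 (inord i).
have := sqr_sum_le m.*2.+1 (fun j => (-1) ^+ j * (X j + X (cyc_next m.*2.+1 j))).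
rewrite cyc_alternating_sum; under eq_bigr do rewrite exprMn sqrr_sign mul1r.
rewrite -/(X _); set Q := \sum_(j < _) _ => H.
have -> : v 0 0 = X 0%N by congr (v 0 _); apply/val_inj; rewrite /= inordK.
have -> : r ^+ 2 * X 0%N ^+ 2 = (r / 2) ^+ 2 * (2 * X 0%N) ^+ 2 by field.
by rewrite [leRHS]mulrCA; apply: (ler_wpM2l (sqr_ge0 _)).
Qed.

(** The seam bound [cyc_mx_ge] gives [v 0 0 = 0]; then each vanishing average carries the zero to
    the next site. *)
Lemma cyc_mx_inj {R : realType} {r : R} {n m : nat} {v : 'rV[R]_n.+1} :
  0 < r -> (m.*2.+1 <= n.+1)%N -> v *m cyc_mx r n.+1 m.*2.+1 = 0 ->
  forall i : 'I_n.+1, (i < m.*2.+1)%N -> v 0 i = 0.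
Proof.
move=> r0 Nn v0.
have r2 : r / 2 != 0 by rewrite mulf_neq0 ?invr_eq0 ?pnatr_eq0 // lt0r_neq0.
have := cyc_mx_ge r v Nn; rewrite v0 /sqnormv.
rewrite [X in _ <= _ * X]big1 => [|i _]; last by rewrite mxE expr0n.
rewrite mulr0 -exprMn => v00.
have {v00} : v 0 0 = 0.
  have /eqP : (r * v 0 0) ^+ 2 = 0 by apply: le_anti; rewrite v00 sqr_ge0.
  by rewrite sqrf_eq0 mulf_eq0 (gt_eqF r0) /= => /eqP.
have -> : v 0 0 = v 0 (inord 0) by congr (v 0 _); apply/val_inj; rewrite /= inordK.
move=> v00; suff vi j : (j < m.*2.+1)%N -> v 0 (inord j) = 0.
  by move=> i iN; rewrite -[i]inord_val vi.
elim: j => // i IHi iN.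
have := congr1 (fun w : 'rV_n.+1 => w 0 (inord i)) v0.
have i_n : (i < n.+1)%N by rewrite (leq_trans _ Nn) // ltnW.
rewrite mul_cyc_mx // [RHS]mxE inordK // (ltnW iN) /cyc_next iN.
move/eqP; rewrite mulf_eq0 (negPf r2) /= IHi ?add0r; last exact: ltnW.
by move/eqP.
Qed.

(** * Bilinear functions centred at a saddle point *)

Definition bilin {R : realType} {n : nat} (A : 'M[R]_n) (s z : pt R n) : R :=
  ((z.1 - s.1) *m A *m (z.2 - s.2)^T) 0 0.

Lemma affine_row {R : realType} {n : nat} (b : 'rV[R]_n) (x0 : 'rV[R]_n) :
  affine (fun x => ((x - x0) *m b^T) 0 0).
Proof.
move=> x y t.
have -> : t *: x + (1 - t) *: y - x0 = t *: (x - x0) + (1 - t) *: (y - x0).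
  by apply/rowP => i; rewrite !mxE; ring.
have lin (B C : 'M[R]_1) : (t *: B + (1 - t) *: C) 0 0 = t * B 0 0 + (1 - t) * C 0 0.
  by rewrite !mxE.
by rewrite mulmxDl -!scalemxAl lin.
Qed.

Lemma biaffine_bilin {R : realType} {n : nat} (A : 'M[R]_n) (s : pt R n) :
  biaffine (bilin A s).
Proof.
split=> [y | x]; rewrite /bilin /= => a b t.
  have := affine_row ((y - s.2) *m A^T) s.1 a b t.
  by rewrite trmx_mul trmxK !mulmxA.
have := affine_row ((x - s.1) *m A) s.2 a b t.
have trE w : ((w - s.2) *m ((x - s.1) *m A)^T) 0 0 = ((x - s.1) *m A *m (w - s.2)^T) 0 0.
  by rewrite -[in RHS](trmxK (_ *m A)) -trmx_mul [RHS]mxE.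
by rewrite !trE.
Qed.

Lemma grad_bilin {R : realType} {n : nat} (A : 'M[R]_n) (s z : pt R n) :
  grad (bilin A s) z = ((z.2 - s.2) *m A^T, (z.1 - s.1) *m A).
Proof.
have subE (B C : 'M[R]_1) : B 0 0 - C 0 0 = (B - C) 0 0 by rewrite !mxE.
case: z => x y; rewrite /grad; congr pair; apply/rowP => i.
- rewrite (gradx_biaffine (biaffine_bilin A s)) /bilin /= subE -!mulmxBl.
  rewrite opprB addrA subrK subr0 -mulmxA -rowE mxE.
  by rewrite -[A in LHS]trmxK -trmx_mul mxE.
- rewrite (grady_biaffine (biaffine_bilin A s)) /bilin /= subE -!mulmxBr -linearB /=.
  rewrite opprB addrA subrK subr0 trmx_delta -colE.
  by rewrite mxE.
Qed.

Lemma saddle_bilin {R : realType} {n : nat} (A : 'M[R]_n) (s : pt R n) :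
  saddle (bilin A s) s.
Proof. by move=> x y; rewrite /bilin /= !subrr !mul0mx trmx0 !mulmx0. Qed.

(** With [u = v A^T] the product of [u A] and [v] is [|u|^2], so expanding [|u A - r^2 v|^2 >= 0]
    and bounding [|u A|^2] by [r^2 |u|^2] suffices. *)
Lemma trmx_op_le {R : realType} {n : nat} {A : 'M[R]_n} {r : R} :
  0 < r -> (forall v, sqnormv (v *m A) <= r ^+ 2 * sqnormv v) ->
  forall v, sqnormv (v *m A^T) <= r ^+ 2 * sqnormv v.
Proof.
move=> r0 Ale v; set u := v *m A^T.
have uA : (u *m A *m v^T) 0 0 = sqnormv u.
  by rewrite sqnormvE -mulmxA {2}/u trmx_mul trmxK.
have sqB (a b : 'rV[R]_n) c : sqnormv (a - c *: b)
    = sqnormv a - 2 * c * (a *m b^T) 0 0 + c ^+ 2 * sqnormv b.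
  rewrite /sqnormv [(a *m _) 0 0]mxE !mulr_sumr -sumrB -big_split.
  by apply: eq_bigr => i _; rewrite !mxE /=; ring.
have := sqnormv_ge0 (u *m A - r ^+ 2 *: v); rewrite sqB uA => H.
have {}H : 0 <= r ^+ 2 * (r ^+ 2 * sqnormv v - sqnormv u) by have := Ale u; nra.
by move: H; rewrite pmulr_rge0 ?subr_ge0 // exprn_gt0.
Qed.

Lemma smooth_bilin {R : realType} {n : nat} {A : 'M[R]_n} {r : R} (s : pt R n) :
  0 < r -> (forall v, sqnormv (v *m A) <= r ^+ 2 * sqnormv v) ->
  smooth r (bilin A s).
Proof.
move=> r0 Ale; apply/(smooth_sqnorm (ltW r0)) => z w.
have gE u : Gop (bilin A s) u = ((u.2 - s.2) *m A^T, - ((u.1 - s.1) *m A)).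
  by have := grad_bilin A s u; rewrite /Gop /grad => -[-> ->].
rewrite !gE /ptsub /sqnorm /= -opprD sqnormvN -!mulmxBl.
rewrite !opprB !addrA !subrK [leLHS]addrC mulrDr.
by apply: lerD; [exact: Ale | exact: trmx_op_le r0 Ale _].
Qed.

(** * Spread of information and the hard instance *)

Lemma span_coord0 {R : realType} {n : nat} {X : seq 'rV[R]_n} {v : 'rV[R]_n} {i : 'I_n} :
  v \in <<X>>%VS -> (forall u, u \in X -> u 0 i = 0) -> v 0 i = 0.
Proof.
move=> vX X0; rewrite (coord_span (X := in_tuple X) vX) summxE big1 // => l _.
by rewrite mxE X0 ?mulr0 // mem_nth.
Qed.

(* Alternating around the odd cycle, with equal values at the sites [m] and [m+1]
   only, so that its cyclic averages vanish except at the site [m]. *)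
Definition alt_row {R : realType} (a : R) (n m : nat) : 'rV[R]_n :=
  \row_i if (i < m.*2.+1)%N then (-1) ^+ (i + (m < i)%N) * a else 0.

Lemma sqnormv_alt_row {R : realType} (a : R) (n m : nat) :
  (m.*2.+1 <= n)%N -> sqnormv (alt_row a n m) = m.*2.+1%:R * a ^+ 2.
Proof.
move=> Nn; transitivity (\sum_(i < n | (i < m.*2.+1)%N) a ^+ 2).
  rewrite [RHS]big_mkcond; apply: eq_bigr => i _; rewrite mxE.
  by case: ifP => _; rewrite ?expr0n // exprMn sqrr_sign mul1r.
by rewrite (sum_ord_lt (fun=> a ^+ 2) Nn) sumr_const card_ord mulr_natl.
Qed.

Lemma alt_row_cyc_mx {R : realType} (r a : R) {n m : nat} (i : 'I_n.+1) :
  (m.*2.+1 <= n.+1)%N -> i != m :> nat ->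
  (alt_row a n.+1 m *m cyc_mx r n.+1 m.*2.+1) 0 i = 0.
Proof.
move=> Nn im; rewrite mul_cyc_mx //; case: ifP => // iN.
rewrite inord_val !mxE iN inordK ?(leq_trans (cyc_nextP iN) Nn) // (cyc_nextP iN).
rewrite -mulrDl /cyc_next; case: ifP => iN1.
  have -> : (m < i.+1)%N = (m < i)%N by lia.
  by rewrite addSn exprS mulN1r subrr mul0r mulr0.
(* On the closing edge [i = 2 m] differs from [m], so [m > 0] and the sign at [i] is opposite to the
   sign at 0. *)
have -> : nat_of_ord i = m.*2 by lia.
have -> : (m < m.*2)%N by lia.
by rewrite addn1 exprS -signr_odd odd_double /= !expr0 mulr1 addNr mul0r mulr0.
Qed.

(* The cycle has the sites [2 i] for [x_i] and [2 i + 1] for [y_i]; only [y_m] sees a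
   nonzero gradient at the start, so at time [j] the iterates have moved only
   at sites at distance less than [j] from [2 m + 1]. *)
Lemma iterate_support {R : realType} (r a : R) {n m : nat} (z0 : pt R n.+1)
    (L := bilin (cyc_mx r n.+1 m.*2.+1) (z0.1 - alt_row a n.+1 m, z0.2))
    (A : algorithm R n.+1) (j : nat) :
  (m.*2.+1 <= n.+1)%N -> in_Asep A -> (j <= m.*2.+1)%N ->
  (forall i : 'I_n.+1,
     ~~ [&& m.*2.+1 < i.*2 + j, i.*2 < m.*2.+1 + j & i < m.*2.+1]%N ->
     ((iterate A L z0 j).1 - z0.1) 0 i = 0) /\
  (forall i : 'I_n.+1,
     ~~ [&& m.*2 < i.*2 + j, i.*2 < m.*2 + j & i < m.*2.+1]%N ->
     ((iterate A L z0 j).2 - z0.2) 0 i = 0).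
Proof.
move=> Nn HA; elim/ltn_ind: j => j IHj jN.
case: j => [|j] in IHj jN *.
  by rewrite /iterate /= !subrr; split=> i _; rewrite mxE.
have [xspan yspan] := HA L z0 j.+1 isT.
split=> i iS.
- apply: (span_coord0 xspan) => _ /mapP[l + ->]; rewrite mem_iota /= add0n => lj.
  have [_ IHy] := IHj l lj (leq_trans (ltnW lj) jN).
  have [-> _] := grad_bilin (cyc_mx r n.+1 m.*2.+1)
    (z0.1 - alt_row a n.+1 m, z0.2) (iterate A L z0 l).
  rewrite mxE big1 // => i' _; rewrite !mxE /=.
  case: ifP => i'N; last by rewrite mulr0.
  case: (boolP [&& m.*2 < i'.*2 + l, i'.*2 < m.*2 + l & i' < m.*2.+1]%N) => i'S; last first.
    by have := IHy i' i'S; rewrite !mxE => ->; rewrite mul0r.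
  (* A neighbour of a site active at time [l <= j] is within reach at time [j + 1], unlike [i]. The
     bound on [j] keeps the active sites away from the seam. *)
  have [-> ->] : (i == i' :> nat) = false /\ (i == cyc_next m.*2.+1 i' :> nat) = false.
    by move: iS i'S; rewrite /cyc_next; case: ifP; lia.
  by rewrite addr0 !mulr0.
- apply: (span_coord0 yspan) => _ /mapP[l + ->]; rewrite mem_iota /= add0n => lj.
  have [IHx _] := IHj l lj (leq_trans (ltnW lj) jN).
  have [_ ->] := grad_bilin (cyc_mx r n.+1 m.*2.+1)
    (z0.1 - alt_row a n.+1 m, z0.2) (iterate A L z0 l).
  (* The displacement from the saddle point is the movement plus [alt_row], whose only contribution
     is to the [y]-site [m], already active at time 1. *)
  rewrite /= opprB addrA addrAC mulmxDl mxE alt_row_cyc_mx //; last by move: iS; lia.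
  rewrite addr0 mxE big1 // => i' _; rewrite !mxE /=.
  case: ifP => iN; last by rewrite mulr0.
  case: (boolP [&& m.*2.+1 < i'.*2 + l, i'.*2 < m.*2.+1 + l & i' < m.*2.+1]%N) => i'S; last first.
    by have := IHx i' i'S; rewrite !mxE => ->; rewrite mul0r.
  have [-> ->] : (i' == i :> nat) = false /\ (i' == cyc_next m.*2.+1 i :> nat) = false.
    by move: iS i'S; rewrite /cyc_next; case: ifP; lia.
  by rewrite addr0 !mulr0.
Qed.

Lemma hard_instance {R : realType} {r D : R} {k n : nat} (z0 : pt R n) :
  0 < r -> 0 < D -> (k + 2 <= n)%N ->
  exists (L : pt R n -> R) (s : pt R n),
    [/\ biaffine L, smooth r L, closest_saddle L z0 s, sqnorm (ptsub z0 s) = D ^+ 2 &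
      forall A : algorithm R n, in_Asep A ->
        r ^+ 2 * D ^+ 2 / (2 * k./2 + 1)%:R ^+ 2 <= sqnorm (grad L (iterate A L z0 k))].
Proof.
case: n z0 => [|n] z0 r0 D0; first by rewrite addn2.
move=> kn; set m := k./2; set N := m.*2.+1.
have NE : (2 * m + 1)%N = N by rewrite addn1 mul2n.
have kN : (k <= N)%N by rewrite /N /m; lia.
have Nn : (N <= n.+1)%N. by move: kn; rewrite /N /m; lia.
have N0 : N%:R != 0 :> R by rewrite pnatr_eq0.
(* All [N] nonzero entries of [e] have size [a]; this value makes its norm [D]. *)
pose a := D / Num.sqrt N%:R.
have a2 : N%:R * a ^+ 2 = D ^+ 2.
  by rewrite expr_div_n sqr_sqrtr ?ler0n // mulrC divfK.
pose e := alt_row a n.+1 m; pose s : pt R n.+1 := (z0.1 - e, z0.2).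
pose C := cyc_mx r n.+1 N; pose L := bilin C s.
have se : ptsub z0 s = (e, 0) by rewrite /ptsub /= subrr opprB addrC subrK.
have nse : sqnorm (ptsub z0 s) = sqnormv e.
  by rewrite se /sqnorm /= [X in _ + X]big1 ?addr0 // => i _; rewrite mxE expr0n.
exists L, s; split.
- exact: biaffine_bilin.
- by apply: smooth_bilin r0 _ => v; apply: cyc_mx_le.
- split; first exact: saddle_bilin.
  move=> s' /(saddle_grad0 (biaffine_bilin C s)) [_ gy0].
  have [_ gyE] := grad_bilin C s s'; rewrite gy0 in gyE.
  (* Every saddle point agrees with [s] in the first [N] coordinates of [x], which carry all of
     [z0 - s]; hence none is closer. *)
  have d0 := cyc_mx_inj r0 Nn (esym gyE).
  rewrite /enorm ler_sqrt ?addr_ge0 ?sqnormv_ge0 // nse.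
  rewrite -[leLHS]addr0 lerD ?sqnormv_ge0 //.
  apply: ler_sum => i _; case: (ltnP i N) => iN; last first.
    by rewrite mxE ltnNge iN expr0n sqr_ge0.
  have := d0 i iN; rewrite !mxE; move: (if _ then _ else _) => c H.
  by have -> : c = z0.1 0 i - s'.1 0 i by lra.
- by rewrite nse sqnormv_alt_row.
- move=> A HA; have [+ _] := iterate_support r a z0 A k Nn HA kN.
  move/(_ 0); rewrite -/C -/e -/s -/L => x00.
  have [_ gyE] := grad_bilin C s (iterate A L z0 k).
  rewrite NE; apply: (@le_trans _ _ (sqnormv (grady L (iterate A L z0 k)))); last first.
    by rewrite lerDr sqnormv_ge0.
  rewrite gyE; set v := _ - _.
  (* The coordinate [x_0] has not moved by time [k], so it still holds its initial displacement. *)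
  have v0 : v 0 0 ^+ 2 = a ^+ 2.
    have -> : v = ((iterate A L z0 k).1 - z0.1) + e by rewrite /v /s /= opprB addrA addrAC.
    rewrite mxE x00 ?add0r; first by rewrite mxE /= exprMn sqrr_sign mul1r.
    by rewrite negb_and -leqNgt double0 add0n kN.
  have := cyc_mx_ge r v Nn; rewrite v0 -/N -/C -a2 => H.
  rewrite ler_pdivrMr ?exprn_gt0 ?ltr0n //.
  have -> : r ^+ 2 * (N%:R * a ^+ 2) = N%:R * (r ^+ 2 * a ^+ 2) by ring.
  rewrite [leRHS]mulrC [N%:R ^+ 2]expr2 -[leRHS]mulrA.
  by apply: ler_wpM2l; rewrite ?ler0n.
Qed.

Theorem theorem3 (R : realType) (r : R) (k n : nat) :
  0 < r -> (k + 2 <= n)%N ->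
  (* (i) *)
  (forall z0 : pt R n,
     exists L : pt R n -> R,
       biaffine L /\ smooth r L /\
       exists zs : pt R n, closest_saddle L z0 zs /\
         forall A : algorithm R n, in_Asep A ->
           r ^+ 2 * sqnorm (ptsub z0 zs) / ((2 * k./2 + 1)%:R) ^+ 2
             <= sqnorm (grad L (iterate A L z0 k)))
  /\
  (* (ii) *)
  (forall D : R, 0 < D ->
     ereal_inf [set S : \bar R | exists A : algorithm R n, in_Asep A /\
        S = ereal_sup [set v : \bar R | exists (L : pt R n -> R) (z0 : pt R n),
               (biaffine L /\ smooth r L) /\
               (exists s : pt R n, saddle L s /\ enorm (ptsub z0 s) <= D) /\
               v = (sqnorm (grad L (iterate A L z0 k)))%:E]]%classic
     = ((r ^+ 2 * D ^+ 2 / ((2 * k./2 + 1)%:R) ^+ 2)%:E)).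
Proof.
move=> r0 kn; split=> [z0|D D0].
  (* Part (i) is relative to the distance, so distance 1 serves. *)
  have [L [s [BL SL cs nD low]]] := hard_instance z0 r0 ltr01 kn.
  by exists L; split=> //; split=> //; exists s; split=> // A HA; rewrite nD low.
apply/le_anti/andP; split; last first.
  apply/ereal_infP => _ [A [HA ->]]; apply: le_ereal_sup_tmp.
  have [L [s [BL SL [sad _] nD low]]] := hard_instance (0, 0) r0 D0 kn.
  exists (sqnorm (grad L (iterate A L (0, 0) k)))%:E; last by rewrite lee_fin low.
  exists L, (0, 0); split=> //; split=> //; exists s; split=> //.
  by rewrite /enorm nD sqrtr_sqr gtr0_norm.
case: n kn => [|n] kn; first by rewrite addn2 in kn.
(* One algorithm serves all functions and starting points: its coefficients depend only on [r] and
   [k]. *)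
apply: ge_ereal_inf; eexists.
  by exists (krylov_alg k (cheb_coef r k)); split; first exact: krylov_alg_in_Asep.
apply/ereal_supP => _ [L [z0 [[BL SL] [[s [sad sD]] ->]]]]; rewrite lee_fin.
apply: le_trans (krylov_alg_rate k z0 r0 BL SL sad) _.
rewrite ler_pM2r ?invr_gt0 ?exprn_gt0 ?ltr0n ?addn1 // ler_pM2l ?exprn_gt0 //.
rewrite -[leLHS]sqr_sqrtr ?addr_ge0 ?sqnormv_ge0 //.
by rewrite ler_pXn2r ?nnegrE ?sqrtr_ge0 // ltW.
Qed.
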